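(* Let $m,k\ge 1$ be integers, $q=2^{km}$ and $d=2^m$, and let $\mathrm{AG}(2,q)$ be the affine plane obtained from $\mathrm{PG}(2,q)$ by deleting the line $z=0$. Then there exist $\frac{q-1}{d-1}$ Denniston maximal arcs $A_1,\dots,A_{\frac{q-1}{d-1}}$ of degree $d$ in $\mathrm{PG}(2,q)$, each contained in $\mathrm{AG}(2,q)$, and a point $P$ such that $A_i\cap A_j=\{P\}$ for all $i\neq j$ and $\bigcup_i A_i$ is the whole point set of $\mathrm{AG}(2,q)$; the point $P$ is the nucleus of each $A_i$; and there is a cyclic group $G$ of collineations of $\mathrm{PG}(2,q)$ which stabilizes each $A_i$ and acts sharply transitively (regularly) on $A_i\setminus\{P\}$ for every $i$.
   Context: A maximal arc of degree $d$ in a projective plane of order $q$ (with $d\mid q$) is a set $A$ of $(q-q/d+1)d$ points such that every line is either disjoint from $A$ or meets $A$ in exactly $d$ points. Denniston arcs: let $q$ be even, let $b\in\mathbb{F}_q$ be such that $x^2+bx+1$ is irreducible over $\mathbb{F}_q$, and for $l\in\mathbb{F}_q$ let $F_l$ be the set of points of $\mathrm{PG}(2,q)$ satisfying $x^2+bxy+y^2+lz^2=0$ (so $F_0=\{(0,0,1)\}$ and for $l\ne0$, $F_l$ is a nondegenerate conic with nucleus $(0,0,1)$). For any additive subgroup $H$ of $\mathbb{F}_q$ of order $d$, the set $\bigcup_{l\in H}F_l$ is a maximal arc of degree $d$; a Denniston (maximal) arc is a maximal arc projectively equivalent to one of this form, and its nucleus is the point corresponding to $(0,0,1)$. *)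

(* Defs.v *)
From HB Require Import structures.
From mathcomp Require Import all_boot all_order all_algebra all_fingroup all_solvable.

Set Implicit Arguments.
Unset Strict Implicit.
Unset Printing Implicit Defensive.

Import GRing.Theory.
Local Open Scope ring_scope.

HB.instance Definition _ (F : finFieldType) (vT : vectType F) :
  isCountable {vspace vT} := CanIsCountable (@VectorInternalTheory.vs2mxK F vT).
HB.instance Definition _ (F : finFieldType) (vT : vectType F) :
  isFinite {vspace vT} := CanIsFinite (@VectorInternalTheory.vs2mxK F vT).

(* The points of PG(2,q), q = #|F|: the 1-dimensional subspaces of F^3.
   Row vectors carry the homogeneous coordinates (x,y,z). *)
Record point (F : finFieldType) : Type :=
  Point { pspace : {vspace 'rV[F]_3}; _ : \dim pspace == 1%N }.

HB.instance Definition _ (F : finFieldType) := [isSub for @pspace F].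
HB.instance Definition _ (F : finFieldType) := [Finite of point F by <:].

Section PG2.
Variable F : finFieldType.
Implicit Types (v : 'rV[F]_3) (A : {set point F}) (g : {perm point F}).

Definition cx v : F := v ord0 (@Ordinal 3 0 isT).
Definition cy v : F := v ord0 (@Ordinal 3 1 isT).
Definition cz v : F := v ord0 (@Ordinal 3 2 isT).

(* [P] is homogeneous in all uses, so that requiring it of every vector of the
   subspace [p] amounts to requiring it of one spanning vector. *)
Definition locus (P : pred 'rV[F]_3) : {set point F} :=
  [set p : point F | [forall v, (v \in pspace p) ==> P v]].

Lemma dim_origin : \dim <[delta_mx ord0 ord_max : 'rV[F]_3]>%VS == 1%N.
Proof.
rewrite dim_vline; suff -> : delta_mx ord0 ord_max != 0 :> 'rV[F]_3 by [].
apply/eqP => /matrixP/(_ ord0 ord_max)/eqP.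
by rewrite !mxE !eqxx oner_eq0.
Qed.

(* The point (0,0,1). *)
Definition origin : point F := Point dim_origin.

(* Lines are identified with their sets of points. *)
Definition lines : {set {set point F}} :=
  [set [set p : point F | (pspace p <= U)%VS]
    | U : {vspace 'rV[F]_3} & \dim U == 2%N].

Definition line_at_infinity : {set point F} := locus (fun v => cz v == 0).

Definition AG : {set point F} := ~: line_at_infinity.

Definition collineation g : Prop :=
  forall L : {set point F}, (g @: L \in lines) = (L \in lines).

Definition projectivity g : Prop :=
  exists2 M : 'M[F]_3, M \in unitmx &
    forall (p : point F) v, (v *m M \in pspace (g p)) = (v \in pspace p).

Definition maximal_arc (d : nat) A : Prop :=
  [/\ (d %| #|F|)%N,
      #|A| = ((#|F| - #|F| %/ d + 1) * d)%N &
      forall L, L \in lines -> A :&: L = set0 \/ #|A :&: L| = d].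

(* Degenerate for l = 0: when x^2 + bx + 1 is irreducible, [conic b 0] is the
   single point (0,0,1). *)
Definition conic (b l : F) : {set point F} :=
  locus (fun v => cx v ^+ 2 + b * cx v * cy v + cy v ^+ 2 + l * cz v ^+ 2 == 0).

(* [A] is a Denniston maximal arc of degree [d] having [N] as a nucleus. The
   nucleus is a relation and not a function of [A]: for d = q, for instance,
   [A] is the complement of a line and every point of [A] is a nucleus. *)
Definition denniston_nucleus (d : nat) A (N : point F) : Prop :=
  maximal_arc d A /\
  exists (b : F) (H : {set F}) (g : {perm point F}),
    [/\ irreducible_poly ('X^2 + b *: 'X + 1),
        zmod_closed H /\ #|H| = d,
        projectivity g,
        A = g @: (\bigcup_(l in H) conic b l) &
        N = g origin].

Definition denniston_arc (d : nat) A : Prop :=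
  exists N, denniston_nucleus d A N.

Definition sharply_transitive (G : {set {perm point F}}) A : Prop :=
  forall x y, x \in A -> y \in A -> exists! g, g \in G /\ g x = y.

End PG2.

(* Main.v *)
Require Import Defs.
From HB Require Import structures.
From mathcomp Require Import all_boot all_order all_algebra all_fingroup all_solvable.
From mathcomp Require Import all_field ring zify.

(* Choose [b] such that [t^2 + b t + 1] has no root in [F], and identify the affine
   plane with the quadratic extension [E] of [F], so that the conic with parameter
   [l] becomes the set of elements of norm [- l]. With [K] the subfield of order
   [d] and [g] a primitive root of [F], the arcs are [A_i = {v | N(v) in g^i K}]:
   since the [g^i K] minus [0] partition the units of [F], the arcs cover [E] and
   meet pairwise in [0] only. Multiplication by the elements of [E] whose norm lies
   in [K] minus [0] preserves every [A_i], and is regular on [A_i] minus [0]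
   because [v / w] has norm in [K] as soon as [v] and [w] are in [A_i]; being a
   finite subgroup of the units of a field, this group is cyclic. A line of the
   plane meets [A_i] in the preimage of an additive group under a map
   [t |-> a t^2 + s t + c], counted with the additivity of [t |-> a t^2 + s t] in
   characteristic 2. *)

Section FiniteField.
Set Implicit Arguments.
Unset Strict Implicit.
Unset Printing Implicit Defensive.
Import GRing.Theory.
Local Open Scope ring_scope.
Variable F : finFieldType.
Implicit Types (a b c s t x y : F) (H : {set F}).

(** * Primitive roots and quadratics without roots *)

Lemma exists_primitive_root : exists g : F, #|F|.-1.-primitive_root g.
Proof.
have q_gt1 := (finNzRing_gt1 F).
have q_gt0 : (0 < #|F|.-1)%N by case: #|F| q_gt1 => [|[]].
(* The nonzero elements are [#|F|.-1] distinct roots of unity of exponent [#|F|.-1], as many as a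
   field can hold, so one of them is primitive. *)
suff /hasP[g _ gP] : has #|F|.-1.-primitive_root (enum (predC1 (0 : F))).
  by exists g.
apply: has_prim_root => //; last by rewrite -cardE cardC1.
  apply/allP => x; rewrite mem_enum inE /= => x_neq0.
  rewrite unity_rootE; apply/eqP/(mulfI x_neq0).
  by rewrite -exprS prednK ?expf_card ?mulr1 // ltnW.
exact: enum_uniq.
Qed.

(* On nonzero [t], the map [t |-> - (t + t^-1)] cannot be onto [F]. *)
Lemma exists_rootless_quadratic :
  exists b, forall t, t ^+ 2 + b * t + 1 != 0.
Proof.
pose f t := - (t + t^-1).
have [b bP] : exists b, b \notin f @: [set t | t != 0].
  apply/existsP; rewrite -negb_forall; apply/negP => /forallP f_onto.
  have le_image : (#|F| <= #|[set t : F | t != 0%R]|)%N.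
    rewrite -cardsT; apply: leq_trans (leq_imset_card f _).
    by apply/subset_leq_card/subsetP => y _; apply: f_onto.
  have card_nz : #|[set t : F | t != 0]| = #|F|.-1.
    by rewrite -(cardC1 (0 : F)) cardsE.
  move: (finNzRing_gt1 F) le_image; rewrite card_nz.
  by case: #|F| => // n; rewrite ltnn.
exists b => t; apply: contra bP => /eqP root_t.
have t_neq0 : t != 0.
  by apply: contra_eq_neq root_t => ->; rewrite mulr0 expr0n !add0r oner_eq0.
apply/imsetP; exists t; rewrite ?inE //.
apply: (mulIf t_neq0); rewrite /f mulNr mulrDl mulVf //.
by apply/eqP; rewrite -subr_eq0 opprK -expr2 addrA addrC -root_t; apply/eqP; ring.
Qed.

Lemma irreducible_rootless_quadratic b :
  (forall t, t ^+ 2 + b * t + 1 != 0) ->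
  irreducible_poly ('X^2 + b *: 'X + 1).
Proof.
move=> no_root; apply: cubic_irreducible => [|t]; last first.
  by rewrite rootE !hornerE; have := no_root t; rewrite expr2.
rewrite -addrA size_polyDl ?size_polyXn //.
apply: leq_ltn_trans (size_polyD _ _) _.
rewrite gtn_max size_poly1 andbT.
by apply: leq_ltn_trans (size_scale_leq _ _) _; rewrite size_polyX.
Qed.

(** * Preimages of additive subgroups under quadratic maps *)

Section ZmodClosed.
Variable H : {set F}.
Hypothesis H_zmod : zmod_closed H.

Lemma zmod_closed_opp x : (- x \in H) = (x \in H).
Proof.
have [H0 HB] := H_zmod.
have HN z : z \in H -> - z \in H by rewrite -sub0r; apply: HB.
by apply/idP/idP => /HN //; rewrite opprK.
Qed.

Lemma zmod_closed_subr x y : y \in H -> (x - y \in H) = (x \in H).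
Proof.
have [H0 HB] := H_zmod; move=> Hy; apply/idP/idP => Hx; last exact: HB.
by rewrite -[x](subrK y) -[X in _ + X]opprK HB // zmod_closed_opp.
Qed.

(* Every fibre of [t |-> a t^2 + B t] has at most two elements. As [c] is not a
   value, each [y] has in total at most two preimages under this map and under
   its translate by [c]; there being [2 * #|F|] preimages, it has exactly two.
   Hence the preimages of [H] under both maps have total size [2 * #|H|], and
   if both are nonempty then they are translates of each other. *)
Lemma card_quadratic_preimage a s c :
  2%:R = 0 :> F -> a != 0 -> (forall t, a * t ^+ 2 + s * t != c) ->
  let S := [set t | a * t ^+ 2 + s * t + c \in H] in
  S = set0 \/ #|S| = #|H|.
Proof.
move=> F2 a_neq0 c_notin /=.
set S := [set t | _].
pose f t := a * t ^+ 2 + s * t.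
have fB t t' : f (t - t') = f t - f t'.
  transitivity (f t - f t' + 2%:R * (a * t' ^+ 2 - a * t * t')).
    by rewrite /f; ring.
  by rewrite F2 mul0r addr0.
pose n y := (#|[set t | f t == y]| + #|[set t | (f t + c)%R == y]|)%N.
have fibre_le2 y : (#|[set t | f t == y]| <= 2)%N.
  have [->|[t0]] := set_0Vmem [set t | f t == y]; first by rewrite cards0.
  rewrite inE => /eqP ft0.
  (* The roots of [a t^2 + s t = y] sum to [- s / a], so [t0] determines the other one. *)
  apply: (@leq_trans #|[set t0; - t0 - s / a]|); last first.
    by rewrite cards2; case: eqP.
  apply/subset_leq_card/subsetP => t; rewrite !inE -ft0 -subr_eq0 => /eqP E.
  have : (t - t0) * (t - (- t0 - s / a)) == 0.
    apply/eqP/(mulfI a_neq0); rewrite mulr0 -E /f.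
    by field.
  by rewrite mulf_eq0 !subr_eq0.
have n_le2 y : (n y <= 2)%N.
  rewrite /n.
  have [->|[t0]] := set_0Vmem [set t | f t == y]; last rewrite inE => /eqP ft0.
    rewrite cards0 add0n.
    suff -> : [set t | f t + c == y] = [set t | f t == y - c] by [].
    by apply/setP => t; rewrite !inE -subr_eq opprK; congr (_ == _).
  (* From [f t0 = y = f t + c], additivity would give [f (t0 - t) = c], which is excluded: at most
     one of the two fibres is nonempty. *)
  have -> : [set t | f t + c == y] = set0.
    apply/setP => t; rewrite !inE; apply/eqP => ft.
    have /negP[] := c_notin (t0 - t); apply/eqP; rewrite -/(f _) fB ft0 -ft.
    by ring.
  by rewrite cards0 addn0.
have sum_fibres (h : F -> F) (P : pred F) :
    (\sum_(y | P y) #|[set t | h t == y]| = #|[set t | P (h t)]|)%N.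
  rewrite -sum1dep_card [RHS](partition_big h P) //=.
  apply: eq_bigr => y Py; rewrite -sum1dep_card; apply: eq_bigl => t.
  by case: eqP => [->|]; rewrite ?Py ?andbT ?andbF.
have sum_n (P : pred F) :
    (\sum_(y | P y) n y = #|[set t | P (f t)]| + #|[set t | P (f t + c)%R]|)%N.
  by rewrite big_split /= sum_fibres (sum_fibres (fun t => f t + c)).
(* The sum of [n] over [F] is [#|F| + #|F|], the maximum allowed by [n_le2], so the bound is
   attained at every [y]. *)
have n_eq2 y : n y = 2.
  have [_] := leqif_sum (fun y (_ : true) => leqif_eq (n_le2 y)).
  rewrite sum_n sum_nat_const !cardsT muln2 addnn eqxx.
  by move=> /esym/forallP/(_ y) /eqP.
have [->|[t0]] := set_0Vmem S; first by left.
rewrite inE -/(f t0) => St0; right.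
have : (#|[set t | f t \in H]| + #|S| = #|H| * 2)%N.
  by rewrite -sum_n -sum_nat_const; apply: eq_bigr => y _.
(* Since [f t0 + c] lies in [H], subtracting it does not affect membership, and translation by [t0]
   matches the two preimages. *)
have -> : [set t | f t \in H] = (+%R^~ t0) @^-1: S.
  apply/setP => t; rewrite !inE -!/(f _) -[RHS](zmod_closed_subr _ St0).
  suff -> : f (t + t0) + c - (f t0 + c) = f t by [].
  by rewrite -[t in RHS](addrK t0) fB; ring.
rewrite card_preimset; last exact: addIr.
by rewrite addnn -muln2 => /eqP; rewrite eqn_pmul2r // => /eqP.
Qed.
End ZmodClosed.

(** * The norm form of the quadratic extension *)

Section NormForm.
Variable b : F.
Hypothesis b_rootless : forall t, t ^+ 2 + b * t + 1 != 0.
Implicit Types u v w : F * F.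

(* [(x, y)] stands for [x + y z] in the quadratic extension of [F] by a root
   [z] of [z^2 = b z - 1]; [qnorm] is the norm, [qmul] the product and [qconj]
   the conjugation of this extension. *)
Definition qnorm v : F := v.1 ^+ 2 + b * v.1 * v.2 + v.2 ^+ 2.
Definition qmul u v : F * F :=
  (u.1 * v.1 - u.2 * v.2, u.1 * v.2 + u.2 * v.1 + b * u.2 * v.2).
Definition qconj v : F * F := (v.1 + b * v.2, - v.2).
Definition qscale t v : F * F := (t * v.1, t * v.2).

Lemma qnormM u v : qnorm (qmul u v) = qnorm u * qnorm v.
Proof. by rewrite /qnorm /=; ring. Qed.

Lemma qnorm_conj v : qnorm (qconj v) = qnorm v.
Proof. by rewrite /qnorm /=; ring. Qed.

Lemma qnormZ t v : qnorm (qscale t v) = t ^+ 2 * qnorm v.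
Proof. by rewrite /qnorm /=; ring. Qed.

Lemma qmulA u v w : qmul (qmul u v) w = qmul u (qmul v w).
Proof. by congr pair => /=; ring. Qed.

Lemma qmul_conj v : qmul v (qconj v) = (qnorm v, 0).
Proof. by rewrite /qnorm; congr pair => /=; ring. Qed.

Lemma qnorm_eq0 v : (qnorm v == 0) = (v == 0).
Proof.
case: v => x y; apply/eqP/eqP => [|[-> ->]]; last by rewrite /qnorm /=; ring.
rewrite /qnorm /= => N0; have [y0|y_neq0] := eqVneq y 0.
  by move: N0; rewrite y0 mulr0 expr0n !addr0 => /eqP; rewrite sqrf_eq0 => /eqP->.
(* Dividing the norm by [y^2] would make [x / y] a root of the quadratic. *)
case/eqP: (b_rootless (x / y)); apply: (mulIf (expf_neq0 2 y_neq0)).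
by rewrite mul0r -N0; field.
Qed.

(** Multiplying further by [qconj v] turns the factor [v] into the nonzero scalar [qnorm v], which
    cancels. *)
Lemma qmulIf v : v != 0 -> injective (qmul^~ v).
Proof.
move=> v_neq0 u w /(congr1 (qmul^~ (qconj v))); rewrite !qmulA qmul_conj.
move: v_neq0; rewrite -qnorm_eq0 => N_neq0; case: u w => [u1 u2] [w1 w2].
rewrite /qmul /= !mulr0 !subr0 !add0r !addr0 => -[/(mulIf N_neq0)-> E].
by rewrite (mulIf N_neq0 E).
Qed.

Lemma qmul_transitive v w : v != 0 ->
  exists2 u, qmul u v = w & qnorm u = qnorm w / qnorm v.
Proof.
rewrite -qnorm_eq0 => N_neq0.
exists (qscale (qnorm v)^-1 (qmul w (qconj v))); last first.
  by rewrite qnormZ qnormM qnorm_conj; field.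
case: v w N_neq0 => [v1 v2] [w1 w2]; rewrite /qnorm /= => N_neq0.
by congr pair => /=; field.
Qed.

Hypothesis F2 : 2%:R = 0 :> F.

Lemma sqr_inj : injective (fun x : F => x ^+ 2).
Proof.
move=> x y /= E; apply/eqP; rewrite -subr_eq0 -sqrf_eq0; apply/eqP.
transitivity (x ^+ 2 - y ^+ 2 + 2%:R * (y ^+ 2 - x * y)); first by ring.
by rewrite E F2 mul0r subrr addr0.
Qed.

(** Squaring is injective on the finite field, so [l = t^2] for some [t]; scaling by [t] carries
    norm 1 to norm [l]. *)
Lemma card_qnorm_fibre l : l != 0 ->
  #|[set v | qnorm v == l]| = #|[set v | qnorm v == 1]|.
Proof.
move=> l_neq0; have := f_invF sqr_inj l; set t := invF _ _ => /= tP.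
have t_neq0 : t != 0 by apply: contra_neq l_neq0 => t0; rewrite -tP t0 expr0n.
have scale_inj : injective (qscale t).
  by move=> [x y] [x' y'] [/(mulfI t_neq0)-> /(mulfI t_neq0)->].
rewrite -(card_preimset _ scale_inj); apply: eq_card => v.
by rewrite !inE qnormZ tP -[X in _ == X]mulr1 (inj_eq (mulfI l_neq0)).
Qed.

Lemma card_qnorm_preimage H : 0 \in H ->
  #|[set v | qnorm v \in H]| = (#|H|.-1 * #|F|.+1).+1.
Proof.
(* Only 0 has norm 0, and the fibres over nonzero values all have the same size. *)
have card_N (K : {set F}) : 0 \in K ->
    #|[set v | qnorm v \in K]| = (#|K|.-1 * #|[set v | qnorm v == 1]|).+1.
  move=> K0; rewrite -sum1dep_card (partition_big qnorm (mem K)) //=.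
  rewrite (bigD1 0) //= -[RHS]add1n; congr (_ + _)%N.
    rewrite (eq_bigl (pred1 0)) ?big_pred1_eq // => v /=.
    by rewrite -qnorm_eq0; case: eqP => [->|]; rewrite ?K0 ?andbF.
  rewrite (eq_bigr (fun _ => #|[set v | qnorm v == 1]|)) => [|l /andP[Kl l_neq0]].
    rewrite (eq_bigl (mem (K :\ 0))) => [|l]; last by rewrite !inE andbC.
    by rewrite sum_nat_const (cardsD1 0 K) K0.
  rewrite -(card_qnorm_fibre l_neq0) -sum1dep_card; apply: eq_bigl => v.
  by case: eqP => [->|]; rewrite ?Kl ?andbF.
move=> H0; rewrite card_N //; congr (_ * _).+1.
(* Taking all of [F] counts the whole plane: [q^2 = (q - 1) N + 1], where [N] is the number of
   elements of norm 1, hence [N = q + 1]. *)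
have := card_N [set: F] (in_setT _).
rewrite (_ : [set v | _] = setT); last by apply/setP => v; rewrite !inE.
rewrite !cardsT card_prod; case: #|F| (finNzRing_gt1 F) => [|[|n]] // _ E.
apply/eqP; rewrite -(eqn_pmul2l (_ : 0 < n.+1)%N) //; apply/eqP.
by apply: succn_inj; rewrite -E; lia.
Qed.

Lemma card_qnorm_line H v w : zmod_closed H -> w != 0 ->
  let S := [set t | qnorm (v.1 + t * w.1, v.2 + t * w.2) \in H] in
  S = set0 \/ #|S| = #|H|.
Proof.
move=> H_zmod w_neq0 /=; set S := [set t | _].
pose s := 2%:R * v.1 * w.1 + b * (v.1 * w.2 + v.2 * w.1) + 2%:R * v.2 * w.2.
have N_line t : qnorm (v.1 + t * w.1, v.2 + t * w.2)
    = qnorm w * t ^+ 2 + s * t + qnorm v.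
  by rewrite /qnorm /s /=; ring.
have N_neq0 : qnorm w != 0 by rewrite qnorm_eq0.
(* In characteristic 2 such a [t0] is a zero of the norm along the line, so the line passes through
   0 there. The norm is then [qnorm w * (t - t0)^2], an injective function of [t]. *)
have [/existsP[t0 /eqP t0P]|/existsPn v_notin] :=
    boolP [exists t, qnorm w * t ^+ 2 + s * t == qnorm v].
  right; pose f t := qnorm w * (t - t0) ^+ 2.
  have f_inj : injective f.
    by move=> t t' /(mulfI N_neq0) /sqr_inj /addIr.
  suff -> : S = f @^-1: H by rewrite card_preimset.
  have /eqP : qnorm (v.1 + t0 * w.1, v.2 + t0 * w.2) = 0.
    by rewrite N_line t0P -mulr2n -mulr_natl F2 mul0r.
  rewrite qnorm_eq0 => /eqP[v1 v2].
  apply/setP => t; rewrite !inE; congr (_ \in H).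
  rewrite -[v.1](addrK (t0 * w.1)) -[v.2](addrK (t0 * w.2)) v1 v2.
  by rewrite /f /qnorm /=; ring.
have -> : S = [set t | qnorm w * t ^+ 2 + s * t + qnorm v \in H].
  by apply/setP => t; rewrite !inE N_line.
exact: card_quadratic_preimage.
Qed.

End NormForm.

(** * Cosets of a multiplicative subgroup *)

Section Cosets.
Variables (d' n : nat) (g : F).
Hypotheses (d'_gt0 : (0 < d')%N) (n_gt0 : (0 < n)%N).
Hypothesis g_prim : (n * d')%N.-primitive_root g.
Hypothesis card_F : #|F|.-1 = (n * d')%N.

(* If [F] has a subfield [K] of order [d'.+1], this is [g ^+ i *: K]. *)
Definition coset0 (i : nat) : {set F} :=
  [set x | x ^+ d'.+1 == g ^+ (i * d') * x].

Let g_neq0 : g != 0.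
Proof.
apply: contra_eq_neq (prim_expr_order g_prim) => ->.
by rewrite expr0n muln_eq0 !eqn0Ngt n_gt0 d'_gt0 eq_sym oner_eq0.
Qed.

Lemma coset0_0 i : 0 \in coset0 i.
Proof. by rewrite inE expr0n mulr0. Qed.

(** Cancelling [g ^+ e] leaves [g ^+ (e * d') = g ^+ (i * d')], and [g] has order [n * d']. The
    cosets thus correspond to the residues of exponents modulo [n]. *)
Lemma coset0_prim i e : (g ^+ e \in coset0 i) = (e == i %[mod n]).
Proof.
rewrite inE exprSr (inj_eq (mulIf (expf_neq0 e g_neq0))) -exprM.
by rewrite (eq_prim_root_expr g_prim) -!muln_modl // eqn_pmul2r.
Qed.

Lemma primitive_log x : x != 0 -> exists2 e, (e < n * d')%N & x = g ^+ e.
Proof.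
move=> x_neq0; have [|e ->] := prim_rootP g_prim (x := x); last by exists e.
apply: (mulfI x_neq0); rewrite -exprS -card_F prednK ?expf_card ?mulr1 //.
exact: ltnW (finNzRing_gt1 F).
Qed.

Lemma coset0_cover x : exists i : 'I_n, x \in coset0 i.
Proof.
have [->|] := eqVneq x 0; first by exists (Ordinal n_gt0); apply: coset0_0.
case/primitive_log => e _ ->; exists (Ordinal (ltn_pmod e n_gt0)).
by rewrite coset0_prim /= modn_mod.
Qed.

Lemma coset0_disjoint (i j : 'I_n) x :
  x != 0 -> x \in coset0 i -> x \in coset0 j -> i = j.
Proof.
case/primitive_log => e _ ->; rewrite !coset0_prim => /eqP-> /eqP.
by rewrite !modn_small // => /val_inj.
Qed.

Lemma coset0_mul i x y : x ^+ d' = 1 -> y \in coset0 i -> x * y \in coset0 i.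
Proof.
by move=> x1; rewrite !inE exprMn => /eqP->; rewrite exprS x1 mulr1 mulrCA.
Qed.

Lemma coset0_div i x y : y != 0 -> x != 0 ->
  x \in coset0 i -> y \in coset0 i -> (x / y) ^+ d' = 1.
Proof.
move=> y_neq0 x_neq0; rewrite !inE !exprSr => /eqP/(mulIf x_neq0) xd.
by move=> /eqP/(mulIf y_neq0) yd; rewrite expr_div_n xd -yd divff // expf_neq0.
Qed.

Lemma card_coset0 (i : 'I_n) : #|coset0 i| = d'.+1.
Proof.
(* The nonzero elements of the coset are the powers of [g] whose exponent below [n * d'] is [i]
   modulo [n]. *)
pose f (j : 'I_d') := g ^+ (i + n * j).
have f_inj : injective f.
  move=> j j' /eqP; rewrite (eq_prim_root_expr g_prim) eqn_modDl -!muln_modr.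
  by rewrite eqn_pmul2l // !modn_small // => /eqP/val_inj.
rewrite (cardsD1 0) coset0_0 add1n; congr _.+1.
rewrite -[RHS]card_ord -(card_imset _ f_inj); apply: eq_card => x.
apply/setD1P/imsetP => [[x_neq0]|[j _ ->]]; last first.
  rewrite expf_neq0 ?g_neq0 // coset0_prim.
  by rewrite mulnC addnC modnMDl.
have [e e_lt ->] := primitive_log x_neq0.
rewrite coset0_prim [(i %% n)%N]modn_small // => /eqP e_i.
have j_lt : (e %/ n < d')%N by rewrite ltn_divLR // mulnC.
by exists (Ordinal j_lt) => //; rewrite /f /= -e_i addnC [(n * _)%N]mulnC -divn_eq.
Qed.

(** As [d'.+1] is a power of the characteristic, both sides of the defining equation are additive in
    [x]. *)
Lemma zmod_closed_coset0 i : [pchar F].-nat d'.+1 -> zmod_closed (coset0 i).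
Proof.
move=> d_nat; split=> [|x y]; first exact: coset0_0.
rewrite !inE => /eqP xd /eqP yd.
by rewrite exprDn_pchar // exprNn_pchar // xd yd mulrBr.
Qed.

End Cosets.

(** * Affine points and Denniston arcs *)

Definition vec3 x y z : 'rV[F]_3 := \row_j nth 0 [:: x; y; z] j.

Lemma vec3_eta (v : 'rV[F]_3) : v = vec3 (cx v) (cy v) (cz v).
Proof.
apply/rowP => -[[|[|[|//]]] lt_j3]; rewrite mxE /=;
  by congr (v _ _); apply: val_inj.
Qed.

Lemma vec3E x y z :
  (cx (vec3 x y z) = x) * (cy (vec3 x y z) = y) * (cz (vec3 x y z) = z).
Proof. by rewrite /cx /cy /cz !mxE. Qed.

Lemma vec3_inj x y z x' y' z' :
  vec3 x y z = vec3 x' y' z' -> [/\ x = x', y = y' & z = z'].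
Proof.
move=> E; split; [move/(congr1 (@cx F)): E | move/(congr1 (@cy F)): E
  | move/(congr1 (@cz F)): E]; by rewrite !vec3E.
Qed.

Lemma vec3_lin t x y z x' y' z' :
  vec3 x y z + t *: vec3 x' y' z' = vec3 (x + t * x') (y + t * y') (z + t * z').
Proof.
by apply/rowP => -[[|[|[|//]]] lt_j3]; rewrite !mxE.
Qed.

Lemma vec3Z t x y z : t *: vec3 x y z = vec3 (t * x) (t * y) (t * z).
Proof. by apply/rowP => -[[|[|[|//]]] lt_j3]; rewrite !mxE. Qed.

Definition avec (v : F * F) : 'rV[F]_3 := vec3 v.1 v.2 1.

Lemma avec_neq0 v : avec v != 0.
Proof.
apply/eqP => /(congr1 (@cz F)); rewrite vec3E /cz mxE => /eqP.
by rewrite oner_eq0.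
Qed.

Lemma dim_affpt v : \dim <[avec v]>%VS == 1%N.
Proof. by rewrite dim_vline avec_neq0. Qed.

Definition affpt v : point F := Point (dim_affpt v).

Lemma pspace_line (p : point F) v : v \in pspace p -> v != 0 -> pspace p = <[v]>%VS.
Proof.
move=> p_v v_neq0; apply/esym/eqP; rewrite eqEdim -memvE p_v /=.
by rewrite dim_vline v_neq0 (eqP (valP p)).
Qed.

Lemma pspace_neq0 (p : point F) : exists2 v, v \in pspace p & v != 0.
Proof.
exists (vpick (pspace p)); rewrite ?memv_pick // vpick0 -dimv_eq0.
by rewrite (eqP (valP p)).
Qed.

Lemma affpt_inj : injective affpt.
Proof.
move=> [x y] [x' y'] /(congr1 (@pspace F)) /= E.
have /vlineP[t] : avec (x, y) \in <[avec (x', y')]>%VS by rewrite -E memv_line.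
by rewrite vec3Z => /vec3_inj /= [-> -> /esym]; rewrite mulr1 => ->; rewrite !mul1r.
Qed.

Lemma AG_affpt p : p \in AG F -> exists v, p = affpt v.
Proof.
rewrite !inE => /forallPn[v]; rewrite negb_imply => /andP[p_v z_neq0].
exists (cx v / cz v, cy v / cz v); apply: val_inj => /=; apply: pspace_line.
  suff -> : avec (cx v / cz v, cy v / cz v) = (cz v)^-1 *: v by rewrite memvZ.
  by rewrite [X in _ *: X]vec3_eta vec3Z mulVf // ![_^-1 * _]mulrC.
exact: avec_neq0.
Qed.

Lemma origin_affpt : origin F = affpt 0.
Proof.
apply: val_inj => /=; congr <[_]>%VS.
by apply/rowP => -[[|[|[|//]]] lt_j3]; rewrite !mxE.
Qed.

Lemma affpt_conic b l v : (affpt v \in conic b l) = (qnorm b v == - l).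
Proof.
rewrite inE -addr_eq0 /qnorm; apply/forallP/idP => [/(_ (avec v))|/eqP N0 u].
  by rewrite memv_line !vec3E expr1n mulr1.
(* Scaling by [t] multiplies the form by [t^2], so its vanishing at [avec v] extends to the whole
   span. *)
apply/implyP => /vlineP[t ->]; rewrite vec3Z !vec3E mulr1.
by rewrite -(mulr0 (t ^+ 2)) -N0; apply/eqP; ring.
Qed.

(** * Unions of conics as maximal arcs *)

Section Arc.
Variable b : F.
Hypothesis b_rootless : forall t, t ^+ 2 + b * t + 1 != 0.

(** At infinity the equation reduces to the vanishing of the norm of [(x, y)], which forces
    [x = y = 0]. *)
Lemma conic_AG l : conic b l \subset AG F.
Proof.
apply/subsetP => p; rewrite !inE => /forallP p_conic; apply/negP => /forallP p_inf.
have [v p_v v_neq0] := pspace_neq0 p; move: v_neq0.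
have /eqP z0 := implyP (p_inf v) p_v.
have := implyP (p_conic v) p_v; rewrite z0 expr0n mulr0 addr0.
rewrite -/(qnorm b (cx v, cy v)) qnorm_eq0 // => /eqP[x0 y0].
rewrite (vec3_eta v) x0 y0 z0 => /eqP[]; apply/rowP => -[[|[|[|//]]] lt_j3];
  by rewrite !mxE.
Qed.

(** The sign in [affpt_conic] disappears because [H] is closed under opposites. *)
Lemma arc_affpt H : zmod_closed H ->
  \bigcup_(l in H) conic b l = affpt @: [set v | qnorm b v \in H].
Proof.
move=> H_zmod; apply/setP => p; apply/bigcupP/imsetP => [[l Hl p_l]|[v]].
  have [v def_p] := AG_affpt (subsetP (conic_AG l) p p_l).
  exists v => //; move: p_l; rewrite def_p affpt_conic inE => /eqP->.
  by rewrite zmod_closed_opp.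
rewrite inE => Hv ->; exists (- qnorm b v); rewrite ?zmod_closed_opp //.
by rewrite affpt_conic opprK.
Qed.

Lemma affine_line (U : {vspace 'rV[F]_3}) : \dim U = 2 ->
  (forall u, avec u \notin U) \/
  exists v w, w != 0 /\
    forall u, avec u \in U <-> exists t, u = (v.1 + t * w.1, v.2 + t * w.2).
Proof.
move=> dimU; have [/existsP[v Uv]|/existsPn] := boolP [exists v, avec v \in U].
  right; pose W := (U :\: <[avec v]>)%VS; pose e := vpick W.
  have capUv : (U :&: <[avec v]> = <[avec v]>)%VS by apply/capv_idPr; rewrite -memvE.
  have dimW : \dim W = 1.
    have := dimv_cap_compl U <[avec v]>; rewrite capUv dim_vline avec_neq0 dimU.
    by case.
  have e_neq0 : e != 0 by rewrite vpick0 -dimv_eq0 dimW.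
  have We : e \in W := memv_pick W.
  have Ue : e \in U by apply: subvP We; apply: diffvSl.
  have v_W0 : (<[avec v]> :&: W = 0)%VS by rewrite capvC capv_diff.
  (* The direction of the line: [e] completes [avec v] to a basis of [U], and subtracting
     [cz e *: avec v] makes its third coordinate 0. *)
  pose w := (cx e - cz e * v.1, cy e - cz e * v.2).
  have e_w : e = vec3 w.1 w.2 0 + cz e *: avec v.
    by rewrite vec3_lin /= !subrK mulr1 add0r -vec3_eta.
  have Uw : vec3 w.1 w.2 0 \in U.
    by rewrite (canRL (addrK _) (esym e_w)) memvB ?memvZ.
  exists v, w; split.
    apply: contra_neq e_neq0 => w0; apply/eqP.
    have : e \in (<[avec v]> :&: W)%VS.
      rewrite memv_cap We andbT e_w w0 (_ : vec3 _ _ _ = 0) ?add0r ?memvZ ?memv_line //.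
      by apply/rowP => -[[|[|[|//]]] lt_j3]; rewrite !mxE.
    by rewrite v_W0 memv0.
  move=> [x y]; split=> [Uu|[t [-> ->]]]; last first.
    have -> : avec (v.1 + t * w.1, v.2 + t * w.2) = avec v + t *: vec3 w.1 w.2 0.
      by rewrite vec3_lin mulr0 addr0.
    by rewrite memvD ?memvZ.
  have : avec (x, y) \in (<[avec v]> + <[e]>)%VS.
    have -> : (<[avec v]> + <[e]> = U)%VS.
      rewrite -(pspace_line (p := Point (introT eqP dimW)) We e_neq0) /=.
      by rewrite addvC -capUv addv_diff_cap.
    by [].
  case/memv_addP => _ /vlineP[s ->] [_ /vlineP[t ->]].
  (* The vector is regrouped on [avec v] and the direction; comparing third coordinates shows that
     the coefficient of [avec v] is 1. *)
  rewrite e_w scalerDr addrCA scalerA -scalerDl addrC vec3Z vec3_lin.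
  move=> /vec3_inj /= [-> -> /esym]; rewrite mulr0 addr0 mulr1 => ->.
  by exists t; rewrite !mul1r.
by left.
Qed.

Lemma arc_maximal H : 2%:R = 0 :> F -> zmod_closed H -> (#|H| %| #|F|)%N ->
  maximal_arc #|H| (\bigcup_(l in H) conic b l).
Proof.
move=> F2 H_zmod dvd_HF; have [H0 _] := H_zmod; split=> // [|L /imsetP[U]].
  rewrite arc_affpt // card_imset; last exact: affpt_inj.
  rewrite card_qnorm_preimage //.
  (* With [q = #|F|] and [d = #|H|], both counts equal [q d - q + d]. *)
  have := (finNzRing_gt1 F); case/dvdnP: dvd_HF => k ->.
  have : (0 < #|H|)%N by apply/card_gt0P; exists 0.
  case: #|H| => // d _ _; rewrite mulnK //; nia.
rewrite inE => /eqP dimU ->; rewrite arc_affpt //.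
have [no_v|[v [w [w_neq0 vwP]]]] := affine_line dimU.
  left; apply/setP => p; rewrite !inE; apply/andP => -[/imsetP[v _ ->]] /=.
  by rewrite -memvE (negPf (no_v v)).
have line_inj : injective (fun t => affpt (v.1 + t * w.1, v.2 + t * w.2)).
  move=> t t' /affpt_inj[/addrI E1 /addrI E2]; apply/eqP.
  (* If [t - t'] were nonzero, it could be cancelled from both coordinates, giving [w = 0]. *)
  rewrite -subr_eq0; apply: contraR w_neq0 => /mulfI inj_t; apply/eqP.
  case: w {vwP} E1 E2 => w1 w2 /= E1 E2.
  by congr pair; apply: inj_t; rewrite mulr0 mulrBl ?E1 ?E2 subrr.
set A := _ :&: _; pose S := [set t | qnorm b (v.1 + t * w.1, v.2 + t * w.2) \in H].
have -> : A = (fun t => affpt (v.1 + t * w.1, v.2 + t * w.2)) @: S.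
  apply/setP => p; rewrite !inE; apply/andP/imsetP.
    case=> /imsetP[u]; rewrite inE => Hu ->; rewrite /= -memvE => /vwP[t def_u].
    by exists t; rewrite ?inE -def_u.
  case=> t; rewrite inE => Ht ->; split; first by apply: imset_f; rewrite inE.
  by rewrite /= -memvE; apply/vwP; exists t.
have [] := card_qnorm_line b_rootless F2 v H_zmod w_neq0; rewrite -/S; last first.
  by right; rewrite card_imset.
by move->; left; rewrite imset0.
Qed.

Lemma arc_denniston H : 2%:R = 0 :> F -> zmod_closed H -> (#|H| %| #|F|)%N ->
  denniston_nucleus #|H| (\bigcup_(l in H) conic b l) (origin F).
Proof.
move=> F2 H_zmod dvd_HF; split; first exact: arc_maximal.
exists b, H, 1%g; split=> //.
- exact: irreducible_rootless_quadratic.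
- by exists 1%:M; [apply: unitmx1 | move=> p v; rewrite mulmx1 perm1].
- by rewrite -[LHS]imset_id; apply: eq_imset => p; rewrite perm1.
- by rewrite perm1.
Qed.

End Arc.

(** * The cyclic group *)

Section ProjectiveAction.
Implicit Type g : {'GL_3[F]}.

Definition glfun g : 'End('rV[F]_3) := linfun (mulmxr (GLval g : 'M[F]_3)).

Lemma glfunE g v : glfun g v = v *m (GLval g : 'M[F]_3).
Proof. by rewrite lfunE. Qed.

Lemma glfun_ker0 g : lker (glfun g) == 0%VS.
Proof.
apply/lker0P => v w; rewrite !glfunE => E.
by rewrite -(mulmxK (GL_unitmx g) v) E (mulmxK (GL_unitmx g)).
Qed.

Lemma glfunM g h : glfun (g * h)%g = (glfun h \o glfun g)%VF.
Proof. by apply/lfunP => v; rewrite comp_lfunE !glfunE GL_MxE mulmxA. Qed.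

Lemma dim_pact (p : point F) g : \dim (glfun g @: pspace p)%VS == 1%N.
Proof.
by rewrite limg_dim_eq ?(eqP (glfun_ker0 g)) ?capv0 // (valP p).
Qed.

Definition pact (p : point F) g : point F := Point (dim_pact p g).

Lemma pact1 : pact^~ 1%g =1 id.
Proof.
move=> p; apply: val_inj => /=; rewrite (_ : glfun 1 = \1%VF) ?lim1g //.
by apply/lfunP => v; rewrite glfunE id_lfunE GL_1E mulmx1.
Qed.

Lemma pactM p : act_morph pact p.
Proof. by move=> g h; apply: val_inj; rewrite /= glfunM limg_comp. Qed.

Canonical pact_action := TotalAction pact1 pactM.

Lemma collineation_pact g : collineation (actperm pact_action g).
Proof.
have lines_pact h L : L \in lines F -> actperm pact_action h @: L \in lines F.
  case/imsetP => U; rewrite inE => dimU ->; apply/imsetP.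
  exists (glfun h @: U)%VS.
    by rewrite inE limg_dim_eq ?(eqP (glfun_ker0 h)) ?capv0.
  apply/setP => p; rewrite inE; apply/imsetP/idP => [[x]|].
    by rewrite inE => Ux ->; rewrite actpermE /= limgS.
  move=> Up; exists (pact p h^-1); last first.
    by rewrite actpermE /= (actKVin pact_action) ?inE.
  rewrite inE -(limg_ker0 _ _ (glfun_ker0 h)) /=.
  by rewrite -limg_comp -glfunM mulVg /= -[X in (X <= _)%VS]/(pspace (pact p 1)) pact1.
(* The converse direction applies [lines_pact] to the inverse of [g]. *)
move=> L; apply/idP/idP => [|]; last exact: lines_pact.
move=> /(lines_pact g^-1%g); rewrite -imset_comp.
rewrite (eq_imset (g := id)) ?imset_id // => p /=.
by rewrite !actpermE /= (actKin pact_action) ?inE.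
Qed.

End ProjectiveAction.

(** * Multiplications by elements whose norm is a root of unity *)

Section NormGroup.
Variables (b : F) (k : nat).
Hypotheses (b_rootless : forall t, t ^+ 2 + b * t + 1 != 0) (k_gt0 : (0 < k)%N).
Implicit Types (u v w : F * F) (g : {'GL_3[F]}).

(** Multiplication by [u] on the affine plane, as a matrix acting on row vectors on the right. *)
Definition qmx u : 'M[F]_3 :=
  \matrix_(i, j) nth 0 (nth [::] [:: [:: u.1; u.2; 0];
    [:: - u.2; u.1 + b * u.2; 0]; [:: 0; 0; 1]] i) j.

Lemma avec_qmx u v : avec v *m qmx u = avec (qmul b u v).
Proof.
apply/rowP => -[[|[|[|//]]] lt_j3]; rewrite !mxE !big_ord_recr big_ord0 /=;
  by rewrite !mxE /=; ring.
Qed.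

Lemma qmxM u v : qmx u *m qmx v = qmx (qmul b u v).
Proof.
apply/matrixP => -[[|[|[|//]]] lt_i3] [[|[|[|//]]] lt_j3];
  by rewrite !mxE !big_ord_recr big_ord0 /= !mxE /=; ring.
Qed.

Lemma qmx1 : qmx (1, 0) = 1%:M.
Proof.
apply/matrixP => -[[|[|[|//]]] lt_i3] [[|[|[|//]]] lt_j3];
  by rewrite !mxE /= ?oppr0 ?mulr0 ?addr0.
Qed.

Lemma unitmx_qmx u : qnorm b u != 0 -> qmx u \in unitmx.
Proof.
rewrite qnorm_eq0 // => u_neq0.
have [v vu _] := qmul_transitive b_rootless (1, 0) u_neq0.
by have [] := @mulmx1_unit _ _ (qmx v) (qmx u); rewrite ?qmxM ?vu ?qmx1.
Qed.

(** When [k.+1] is the order of a subfield, the condition says that the norm is a nonzero element of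
    that subfield. *)
Definition norm_set : {set {'GL_3[F]}} :=
  [set g : {'GL_3[F]} |
    [exists u, (qnorm b u ^+ k == 1) && ((GLval g : 'M[F]_3) == qmx u)]].

Lemma norm_setP g :
  reflect (exists2 u, qnorm b u ^+ k = 1 & (GLval g : 'M[F]_3) = qmx u)
    (g \in norm_set).
Proof.
rewrite inE; apply: (iffP existsP) => -[u].
  by case/andP=> /eqP Nu /eqP gu; exists u.
by move=> Nu gu; exists u; rewrite Nu gu !eqxx.
Qed.

Lemma norm_set_group_set : group_set norm_set.
Proof.
apply/group_setP; split=> [|g h /norm_setP[u Nu gu] /norm_setP[v Nv hv]].
  apply/norm_setP; exists (1, 0); last by rewrite qmx1.
  by rewrite /qnorm /= mulr0 expr0n /= !addr0 !expr1n.
apply/norm_setP; exists (qmul b u v); last by rewrite -qmxM -gu -hv.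
by rewrite qnormM exprMn Nu Nv mulr1.
Qed.
Canonical norm_group := Group norm_set_group_set.

(** Supplies a field in which pairs with the product [qmul] can be realized as [x + y z]. A root of
    [X^2 + b X + 1] is negated to match the relation behind [qmul]. *)
Lemma exists_splitting_root :
  exists (L : fieldType) (e : {rmorphism F -> L}) (z : L), z ^+ 2 = e b * z - 1.
Proof.
have [L _ [z]] := irredp_FAdjoin (irreducible_rootless_quadratic b_rootless).
pose e : {rmorphism F -> L} := GRing.in_alg L.
rewrite -[map_poly _ _]/(map_poly e _) => root_z _.
exists L, e, (- z); move: root_z; rewrite rootE !rmorphD /= map_polyXn map_polyZ /=.
rewrite map_polyX rmorph1 !hornerE => /eqP root_z.
rewrite sqrrN; apply/eqP; rewrite -subr_eq0; apply/eqP; rewrite -root_z.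
by ring.
Qed.

Lemma cyclic_norm_group : cyclic norm_group.
Proof.
have [L [e [z z2]]] := exists_splitting_root.
pose i0 : 'I_3 := ord0; pose i1 : 'I_3 := Ordinal (isT : 1 < 3)%N.
(* The first row of [qmx u] is [u.1, u.2, 0], so [f] recovers the field element [u.1 + u.2 z] from
   the matrix. *)
pose f g : L := e ((GLval g : 'M[F]_3) i0 i0) + e ((GLval g : 'M[F]_3) i0 i1) * z.
have fE g u : (GLval g : 'M[F]_3) = qmx u -> f g = e u.1 + e u.2 * z.
  by move=> gu; rewrite /f gu !mxE.
apply: (@field_mul_group_cyclic _ _ L f).
  move=> g h /norm_setP[u _ gu] /norm_setP[v _ hv].
  rewrite (fE _ _ gu) (fE _ _ hv) (fE _ (qmul b u v)); last by rewrite -qmxM -gu -hv.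
  rewrite /= !(rmorphD, rmorphB, rmorphM) /=.
  transitivity (e u.1 * e v.1 + (e u.1 * e v.2 + e u.2 * e v.1) * z
      + e u.2 * e v.2 * (e b * z - 1)); first by ring.
  by rewrite -z2; ring.
move=> g /norm_setP[u _ gu]; rewrite (fE _ _ gu); split=> [fg1|g1]; last first.
  move: gu; rewrite g1 GL_1E -[1]/(1%:M) -qmx1 => /matrixP gu.
  have := gu i0 i0; have := gu i0 i1; rewrite !mxE /= => <- <-.
  by rewrite rmorph1 rmorph0 mul0r addr0.
apply: val_inj; rewrite /= gu; transitivity (qmx (1, 0)); last by rewrite qmx1.
congr qmx.
suff /eqP : qnorm b (u.1 - 1, u.2) = 0.
  rewrite qnorm_eq0 // => /eqP[/eqP]; rewrite subr_eq0 => /eqP u1 u2.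
  by case: u u1 u2 {gu fg1} => x y /= -> ->.
apply: (fmorph_inj e); rewrite rmorph0.
(* The norm of [u - 1] is its product with its conjugate, modulo the equation of [z]; the first
   factor vanishes since [f g = 1]. *)
transitivity ((e u.1 + e u.2 * z - 1) * (e u.1 - 1 + e u.2 * (e b - z))
   + (e u.2) ^+ 2 * (z ^+ 2 - (e b * z - 1))).
  by rewrite /qnorm /= !(rmorphD, rmorphB, rmorphM, rmorphXn, rmorph1) /=; ring.
by rewrite z2 fg1 !subrr mul0r mulr0 addr0.
Qed.

Definition norm_perm_group : {group {perm point F}} :=
  (actperm pact_action @* norm_group)%G.

Lemma cyclic_norm_perm_group : cyclic norm_perm_group.
Proof. exact: morphim_cyclic cyclic_norm_group. Qed.

Lemma norm_perm_collineation (p : {perm point F}) :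
  p \in norm_perm_group -> collineation p.
Proof. by case/morphimP => g _ _ ->; apply: collineation_pact. Qed.

Lemma norm_permP (p : {perm point F}) : p \in norm_perm_group ->
  exists2 u, qnorm b u ^+ k = 1 & forall v, p (affpt v) = affpt (qmul b u v).
Proof.
case/morphimP => g _ /norm_setP[u Nu gu] ->; exists u => // v.
rewrite actpermE; apply: val_inj => /=.
by rewrite limg_line glfunE gu avec_qmx.
Qed.

Lemma norm_perm_exists u : qnorm b u ^+ k = 1 ->
  exists2 p, p \in norm_perm_group & forall v, p (affpt v) = affpt (qmul b u v).
Proof.
move=> Nu; have N_neq0 : qnorm b u != 0.
  by apply: contra_eq_neq Nu => ->; rewrite expr0n eqn0Ngt k_gt0 eq_sym oner_eq0.
pose g : {'GL_3[F]} := Sub (qmx u : 'M[F]_3.-1.+1) (unitmx_qmx N_neq0).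
exists (actperm pact_action g).
  by apply: mem_morphim; [apply: in_setT | apply/norm_setP; exists u].
move=> v; rewrite actpermE; apply: val_inj => /=.
by rewrite limg_line glfunE /= avec_qmx.
Qed.

(** By [qmulIf] the product [qmul b u v] determines [u], hence the matrix, so the permutations agree
    at infinity too. *)
Lemma norm_perm_free (p p' : {perm point F}) v :
  p \in norm_perm_group -> p' \in norm_perm_group -> v != 0 ->
  p (affpt v) = p' (affpt v) -> p = p'.
Proof.
have actE g u : (GLval g : 'M[F]_3) = qmx u ->
    actperm pact_action g (affpt v) = affpt (qmul b u v).
  move=> gu; rewrite actpermE; apply: val_inj => /=.
  by rewrite limg_line glfunE gu avec_qmx.
case/morphimP => g _ /norm_setP[u _ gu] -> /morphimP[g' _ /norm_setP[u' _ gu'] ->].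
move=> v_neq0; rewrite (actE _ _ gu) (actE _ _ gu') => /affpt_inj.
move/(qmulIf b_rootless v_neq0) => uu'; congr (actperm _ _).
by apply: val_inj; rewrite /= gu gu' uu'.
Qed.

End NormGroup.

(** * Assembling the partition and its group *)

Lemma denniston_partition d' n : (0 < d')%N -> (0 < n)%N ->
  #|F|.-1 = (n * d')%N -> 2 \in [pchar F] -> [pchar F].-nat d'.+1 ->
  (d'.+1 %| #|F|)%N ->
  exists (A : 'I_n -> {set point F}) (P : point F),
    [/\ forall i, denniston_arc d'.+1 (A i) /\ A i \subset AG F,
        forall i j, i != j -> A i :&: A j = [set P],
        \bigcup_i A i = AG F,
        forall i, denniston_nucleus d'.+1 (A i) P
      & exists G : {group {perm point F}},
          [/\ cyclic G,
              forall g, g \in G -> collineation g,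
              forall i g, g \in G -> g @: A i = A i
            & forall i, sharply_transitive G (A i :\ P)]].
Proof.
move=> d'_gt0 n_gt0 card_F char2 d_nat dvd_d; have F2 : 2%:R = 0 :> F by apply: pcharf0.
have [b b_rootless] := exists_rootless_quadratic.
have [g] := exists_primitive_root; rewrite card_F => g_prim.
pose H (i : 'I_n) := coset0 d' g i.
have H_zmod i : zmod_closed (H i) by apply: zmod_closed_coset0.
have H_card i : #|H i| = d'.+1 by apply: card_coset0.
pose A i := \bigcup_(l in H i) conic b l.
have AE i : A i = affpt @: [set v | qnorm b v \in H i] by apply: arc_affpt.
have A_affpt i v : (affpt v \in A i) = (qnorm b v \in H i).
  by rewrite AE mem_imset ?inE //; apply: affpt_inj.
have A_AG i : A i \subset AG F by apply/bigcupsP => l _; apply: conic_AG.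
have A_nucleus i : denniston_nucleus d'.+1 (A i) (origin F).
  by rewrite -(H_card i); apply: arc_denniston; rewrite ?H_card.
have H0 i : 0 \in H i by apply: coset0_0.
have A_point i (x : point F) : x \in A i :\ origin F ->
    exists v, [/\ x = affpt v, v != 0 & qnorm b v \in H i].
  case/setD1P=> x_neq Ax; have [v def_x] := AG_affpt (subsetP (A_AG i) x Ax).
  exists v; rewrite -A_affpt -def_x; split=> //.
  by apply: contraNneq x_neq => v0; rewrite def_x v0 origin_affpt.
exists A, (origin F); split=> //.
- by move=> i; split=> //; exists (origin F).
- move=> i j i_neq_j; apply/setP => x; rewrite !inE.
  apply/andP/eqP => [[Aix Ajx]|->]; last first.
    by rewrite origin_affpt !A_affpt (eqP (_ : qnorm b 0 == 0)) ?qnorm_eq0.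
  apply/eqP; apply: contraNT i_neq_j => x_neq.
  have [|v [def_x v_neq0 Hi]] := A_point i x; first by rewrite !inE x_neq.
  move: Ajx; rewrite def_x A_affpt => Hj; apply/eqP.
  by apply: coset0_disjoint Hi Hj; rewrite ?qnorm_eq0.
- apply/setP => x; apply/bigcupP/idP => [[i _]|/AG_affpt[v ->]].
    exact/subsetP/A_AG.
  have [i Hi] : exists i : 'I_n, qnorm b v \in H i by apply: coset0_cover.
  by exists i => //; rewrite A_affpt.
exists (norm_perm_group b d'); split.
- exact: cyclic_norm_perm_group.
- exact: norm_perm_collineation.
- move=> i p Gp; apply/eqP.
  (* A permutation preserves cardinality, so one inclusion suffices. *)
  rewrite eqEcard card_imset ?leqnn ?andbT; last exact: perm_inj.
  apply/subsetP => _ /imsetP[x Ax ->].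
  have [v def_x] := AG_affpt (subsetP (A_AG i) x Ax).
  have [u Nu pE] := norm_permP Gp; move: Ax; rewrite def_x pE !A_affpt qnormM.
  exact: coset0_mul.
move=> i x y /A_point[v [-> v_neq0 Hv]] /A_point[w [-> w_neq0 Hw]].
(* The quotient [u = w / v] moves [v] to [w]; its norm is a quotient of two nonzero elements of one
   coset, hence a root of unity of exponent [d']. *)
have [u uv Nu] := qmul_transitive b_rootless w v_neq0.
have Nu1 : qnorm b u ^+ d' = 1.
  by rewrite Nu; apply: coset0_div Hw Hv; rewrite // qnorm_eq0.
have [p Gp pE] := norm_perm_exists b_rootless d'_gt0 Nu1.
exists p; split=> [|p' [Gp' p'E]]; first by rewrite pE uv.
by apply: (norm_perm_free b_rootless Gp Gp' v_neq0); rewrite pE uv p'E.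
Qed.

End FiniteField.

Theorem theorem1 (m k : nat) (hm : 1 <= m) (hk : 1 <= k)
    (F : finFieldType) (hF : #|F| = 2 ^ (k * m)) :
  let q := #|F| in
  let d := 2 ^ m in
  exists (A : 'I_((q - 1) %/ (d - 1)) -> {set point F}) (P : point F),
    [/\ forall i, denniston_arc d (A i) /\ A i \subset AG F,
        forall i j, i != j -> A i :&: A j = [set P],
        \bigcup_i A i = AG F,
        forall i, denniston_nucleus d (A i) P
      & exists G : {group {perm point F}},
          [/\ cyclic G,
              forall g, g \in G -> collineation g,
              forall i g, g \in G -> g @: A i = A i
            & forall i, sharply_transitive G (A i :\ P)]].
Proof.
move=> q d; have d_gt1 : 1 < d by rewrite -(expn0 2) ltn_exp2l.
have d'_gt0 : 0 < d.-1 by rewrite -subn1 subn_gt0.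
have q_d : q = d ^ k by rewrite /q hF mulnC expnM.
(* Since [d - 1] divides [d ^ k - 1], the number of arcs is an exact quotient. *)
have dvd_q : d - 1 %| q - 1 by rewrite q_d !subn1 dvdn_pred_predX.
have card_F : q.-1 = (q - 1) %/ (d - 1) * d.-1 by rewrite -!subn1 divnK.
have n_gt0 : 0 < (q - 1) %/ (d - 1).
  by rewrite divn_gt0 ?subn1 // dvdn_leq -?subn1 // subn_gt0 finNzRing_gt1.
have char2 : 2 \in [pchar F]%R := card_finPcharP hF isT.
have prednd : d.-1.+1 = d by rewrite prednK // ltnW.
have := @denniston_partition F d.-1 _ d'_gt0 n_gt0 card_F char2.
rewrite prednd; apply.
  by rewrite pnatX (eq_pnat _ (GRing.pcharf_eq char2)) pnat_id.
by rewrite -/q q_d -[X in X %| _]expn1 dvdn_exp2l.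
Qed.
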